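(* Let $q\in\mathbb{C}$ with $0<|q|<1$, and let $A(z)\not\equiv 0$ be a function analytic at the origin. If $f_1$ and $f_2$ are two linearly independent solutions, analytic at the origin, of the linear Jackson $q$-difference equation $$D_q^2f(z)+A(z)f(z)=0,$$ then $C_J(f_1,f_2)\notin \mathrm{Ker}(D_q)$, i.e. $D_q\big(C_J(f_1,f_2)\big)\not\equiv 0$.
   Context: The Jackson difference operator is $D_qf(z)=\frac{f(qz)-f(z)}{qz-z}$ (for $f$ analytic at the origin this has a removable singularity at $z=0$), and $D_q^2f=D_q(D_qf)$. ''Analytic at the origin'' means analytic in a neighbourhood of $0$. Linear independence is over $\mathbb{C}$. The kernel $\mathrm{Ker}(D_q)$ consists of the functions $g$ with $D_qg\equiv 0$. The Jackson $q$-Casorati determinant of $f_1,f_2$ is $$C_J(f_1,f_2)=f_1\cdot D_qf_2-f_2\cdot D_qf_1.$$ *)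

(* Defs.v *)
From Stdlib Require Import Reals.
From Coquelicot Require Import Coquelicot.
Open Scope C_scope.

(** Functions near the origin are total maps [C -> C] whose values away from [0]
    are irrelevant: every identity between them is an identity of germs. *)
Definition germ_zero (f : C -> C) : Prop :=
  locally (RtoC 0) (fun z => f z = 0).

Definition analytic_at (f : C -> C) (w : C) : Prop :=
  exists a : nat -> C,
    locally w (fun z => is_pseries (K := C_AbsRing) (V := C_NormedModule) a (z - w) (f z)).

Definition analytic_at_origin (f : C -> C) : Prop :=
  locally (RtoC 0) (analytic_at f).

(** At [z = 0] the value is the limit filling the removable singularity;
    [C_lim] is a total operator, equal to the limit whenever the latter exists. *)
Definition Dq (q : C) (f : C -> C) (z : C) : C :=
  if Ceq_dec z 0
  then C_lim (fun w => (f (q * w) - f w) / (q * w - w)) 0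
  else (f (q * z) - f z) / (q * z - z).

Definition in_ker_Dq (q : C) (g : C -> C) : Prop := germ_zero (Dq q g).

Definition casorati (q : C) (f1 f2 : C -> C) (z : C) : C :=
  f1 z * Dq q f2 z - f2 z * Dq q f1 z.

Definition jackson_solution (q : C) (A f : C -> C) : Prop :=
  germ_zero (fun z => Dq q (Dq q f) z + A z * f z).

Definition lin_indep (f1 f2 : C -> C) : Prop :=
  forall c1 c2 : C,
    germ_zero (fun z => c1 * f1 z + c2 * f2 z) -> c1 = 0 /\ c2 = 0.

(* Main.v *)
(* For small nonzero [z] the equation gives
     D_q (C_J(f1, f2)) (z) = A z * (f1 z * f2 (q z) - f2 z * f1 (q z)).
   If this vanishes near [0] then, since zeros of [A] do not accumulate at [0],
   [f1 / f2] is invariant under [z => q z]. Comparing [f1 / f2] at [z] with its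
   behaviour at [q ^ n z] as n grows shows that [f1] and [f2] vanish to the same
   order at [0] and that [f1 / f2] is constant. *)
Require Import Defs.
From Stdlib Require Import Reals Lra Lia Classical Wf_nat.
From Coquelicot Require Import Coquelicot.

Local Open Scope C_scope.

(** * Neighbourhoods of the origin *)

Lemma Cminus_0_r (z : C) : z - 0 = z.
Proof. ring. Qed.

(** The filter [locally] comes from the uniform structure on [C], while [Cmod] is its norm. The two
    give the same neighbourhoods, so germs can be handled on explicit discs. *)
Lemma locally_0_Cmod (P : C -> Prop) :
  locally (RtoC 0) P <->
  exists d : R, (0 < d)%R /\ forall z, (Cmod z < d)%R -> P z.
Proof.
  split.
  - intros H.
    destruct (@locally_norm_le_locally _ C_NormedModule _ _ H) as [d Hd].
    exists d; split; [apply cond_pos|]; intros z Hz; apply Hd.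
    change (Cmod (z - 0) < d)%R.
    now rewrite Cminus_0_r.
  - intros [d [d0 Hd]].
    apply (@locally_le_locally_norm _ C_NormedModule).
    exists (mkposreal d d0); intros z Hz; apply Hd.
    change (Cmod (z - 0) < d)%R in Hz.
    now rewrite Cminus_0_r in Hz.
Qed.

Lemma germ_zero_imp (f g : C -> C) :
  (forall z, f z = 0 -> g z = 0) -> germ_zero f -> germ_zero g.
Proof. intros H; unfold germ_zero; now apply filter_imp. Qed.

(** * Partial sums, coefficient bounds and leading terms of power series *)

Definition psum (a : nat -> C) (z : C) (n : nat) : C :=
  @sum_n C_NormedModule (fun k => a k * z ^ k) n.

Lemma psum_S (a : nat -> C) (z : C) (n : nat) :
  psum a z (S n) = psum a z n + a (S n) * z ^ S n.
Proof. exact (@sum_Sn C_NormedModule _ n). Qed.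

Lemma psum_0 (a : nat -> C) (z : C) : psum a z 0 = a 0%nat.
Proof.
  unfold psum; rewrite sum_O; simpl; ring.
Qed.

Lemma pow_n_Cpow (z : C) (n : nat) : @pow_n C_AbsRing z n = z ^ n.
Proof. induction n as [|n IH]; [reflexivity|]. simpl; now rewrite IH. Qed.

Lemma is_pseries_psum (a : nat -> C) (z l : C) :
  @is_pseries C_AbsRing C_NormedModule a z l ->
  filterlim (psum a z) eventually (@locally C_NormedModule l).
Proof.
  intros H; eapply filterlim_ext; [|exact H].
  intros n; apply sum_n_ext; intros k.
  rewrite pow_n_Cpow; apply Cmult_comm.
Qed.

(** Closed discs are closed: a limit outside the disc would force late partial sums outside too. The
    offset [N] lets the first partial sums be ignored. *)
Lemma psum_limit_bound (a : nat -> C) (z l w : C) (N : nat) (B : R) :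
  @is_pseries C_AbsRing C_NormedModule a z l ->
  (forall m, (Cmod (psum a z (N + m) - w) <= B)%R) ->
  (Cmod (l - w) <= B)%R.
Proof.
  intros H HB.
  apply Rnot_lt_le; intros Hlt.
  apply is_pseries_psum in H.
  assert (e0 : (0 < Cmod (l - w) - B)%R) by lra.
  assert (Hl : @locally C_NormedModule l
            (fun y : C => (Cmod (y - l) < Cmod (l - w) - B)%R)).
  { apply (@locally_le_locally_norm _ C_NormedModule).
    exists (mkposreal _ e0); intros y Hy; exact Hy. }
  destruct (H _ Hl) as [M HM].
  specialize (HM (N + M)%nat ltac:(lia)); simpl in HM.
  specialize (HB M).
  assert (T := Cmod_triangle (psum a z (N + M) - w) (- (psum a z (N + M) - l))).
  rewrite Cmod_opp in T.
  replace (psum a z (N + M) - w + - (psum a z (N + M) - l)) with (l - w) in T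
    by ring.
  lra.
Qed.

(** Convergent partial sums are bounded, and each term is the difference of two consecutive ones;
    hence the bound [M + M]. *)
Lemma pseries_coef_bound (a : nat -> C) (r : R) (l : C) :
  (0 < r)%R ->
  @is_pseries C_AbsRing C_NormedModule a (RtoC r) l ->
  exists M : R, (0 <= M)%R /\ forall n, (Cmod (a n) * r ^ n <= M)%R.
Proof.
  intros r0 H; apply is_pseries_psum in H.
  destruct (@filterlim_bounded _ C_NormedModule (psum a (RtoC r))) as [M HM];
    [now exists l|].
  assert (HM' : forall n, (Cmod (psum a (RtoC r) n) <= M)%R)
    by exact HM.
  assert (M0 : (0 <= M)%R)
    by (eapply Rle_trans; [apply Cmod_ge_0|apply (HM' 0%nat)]).
  exists (M + M)%R; split; [lra|]; intros n.
  assert (E : (Cmod (a n) * r ^ n = Cmod (a n * RtoC r ^ n))%R).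
  { rewrite Cmod_mult, Cmod_pow, Cmod_R, Rabs_pos_eq; lra. }
  rewrite E; destruct n as [|n].
  - replace (a 0%nat * RtoC r ^ 0) with (psum a (RtoC r) 0)
      by (rewrite psum_0; simpl; ring).
    specialize (HM' 0%nat); lra.
  - replace (a (S n) * RtoC r ^ S n)
      with (psum a (RtoC r) (S n) + - psum a (RtoC r) n)
      by (rewrite psum_S; ring).
    eapply Rle_trans; [apply Cmod_triangle|]; rewrite Cmod_opp.
    apply Rplus_le_compat; apply HM'.
Qed.

Lemma psum_first_terms (a : nat -> C) (z : C) (k : nat) :
  (forall j, (j < k)%nat -> a j = 0) -> psum a z k = a k * z ^ k.
Proof.
  destruct k as [|k]; intros H.
  - rewrite psum_0; simpl; ring.
  - rewrite psum_S.
    assert (E : forall j, (j <= k)%nat -> psum a z j = 0).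
    { induction j as [|j IH]; intros Hj.
      - rewrite psum_0; apply H; lia.
      - rewrite psum_S, IH, H by lia; ring. }
    rewrite E by lia; ring.
Qed.

(** With |a n| r^n bounded by M, the terms after index k are dominated by a geometric series of
    ratio t = |z|/r. For t at most 1/2 it sums to at most 2 M t^(k+1). *)
Lemma pseries_leading_term (a : nat -> C) (f : C -> C) (d : R) (k : nat) :
  (0 < d)%R ->
  (forall z, (Cmod z < d)%R -> @is_pseries C_AbsRing C_NormedModule a z (f z)) ->
  (forall j, (j < k)%nat -> a j = 0) ->
  exists K e : R, (0 <= K)%R /\ (0 < e)%R /\
    forall z, (Cmod z < e)%R ->
      (Cmod (f z - a k * z ^ k) <= K * Cmod z ^ S k)%R.
Proof.
  intros d0 Hf Hk.
  set (r := (d / 2)%R).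
  assert (r0 : (0 < r)%R) by (unfold r; lra).
  destruct (pseries_coef_bound a r (f (RtoC r)) r0) as [M [M0 HM]].
  { apply Hf; rewrite Cmod_R, Rabs_pos_eq; unfold r; lra. }
  (* The radius r/2 ensures t <= 1/2, and [K] times |z|^(k+1) is exactly 2 M t^(k+1). *)
  exists (2 * M * / r ^ S k)%R, (r / 2)%R.
  assert (rk : forall n, (0 < r ^ n)%R) by (intros n; apply pow_lt, r0).
  split; [|split; [lra|]].
  { apply Rmult_le_pos; [lra|]; left; apply Rinv_0_lt_compat, rk. }
  intros z Hz.
  apply psum_limit_bound with (a := a) (z := z) (N := k).
  { apply Hf; unfold r in Hz; lra. }
  set (t := (Cmod z / r)%R).
  assert (t0 : (0 <= t)%R).
  { apply Rmult_le_pos; [apply Cmod_ge_0|left; now apply Rinv_0_lt_compat]. }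
  assert (t1 : (t <= / 2)%R).
  { apply Rmult_le_reg_r with r; [easy|].
    unfold t; replace (Cmod z / r * r)%R with (Cmod z) by (field; lra); lra. }
  assert (Et : Cmod z = (t * r)%R) by (unfold t; field; lra).
  assert (tk : forall n, (0 <= t ^ n)%R) by (intros n; now apply pow_le).
  (* The factor 1 - (1/2)^m makes the induction close: passing from m to m+1 raises the bound by M
     t^(k+1) (1/2)^m, which is the estimate [T] for the new term. *)
  assert (B : forall m,
    (Cmod (psum a z (k + m) - a k * z ^ k)
       <= 2 * M * t ^ S k * (1 - (/ 2) ^ m))%R).
  { induction m as [|m IH].
    - rewrite Nat.add_0_r, psum_first_terms by easy.
      replace (a k * z ^ k - a k * z ^ k) with (RtoC 0) by ring.
      rewrite Cmod_0; simpl; lra.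
    - rewrite Nat.add_succ_r, psum_S.
      replace (psum a z (k + m) + a (S (k + m)) * z ^ S (k + m) - a k * z ^ k)
        with ((psum a z (k + m) - a k * z ^ k) + a (S (k + m)) * z ^ S (k + m))
        by ring.
      eapply Rle_trans; [apply Cmod_triangle|].
      assert (T : (Cmod (a (S (k + m)) * z ^ S (k + m))
                    <= M * t ^ S k * (/ 2) ^ m)%R).
      { rewrite Cmod_mult, Cmod_pow, Et, Rpow_mult_distr.
        replace (t ^ S (k + m))%R with (t ^ S k * t ^ m)%R
          by (rewrite <- pow_add; f_equal; lia).
        replace (Cmod (a (S (k + m))) * (t ^ S k * t ^ m * r ^ S (k + m)))%R
          with ((Cmod (a (S (k + m))) * r ^ S (k + m)) * t ^ S k * t ^ m)%R
          by ring.
        apply Rmult_le_compat; [|apply tk| |apply pow_incr; lra].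
        - apply Rmult_le_pos; [|apply tk].
          apply Rmult_le_pos; [apply Cmod_ge_0|left; apply rk].
        - apply Rmult_le_compat_r; [apply tk|apply HM]. }
      change ((/ 2) ^ S m)%R with (/ 2 * (/ 2) ^ m)%R.
      lra. }
  intros m; eapply Rle_trans; [apply B|].
  replace (2 * M * / r ^ S k * Cmod z ^ S k)%R with (2 * M * t ^ S k * 1)%R.
  - apply Rmult_le_compat_l; [apply Rmult_le_pos; [lra|apply tk]|].
    assert (0 < (/ 2) ^ m)%R by (apply pow_lt; lra); lra.
  - rewrite Et, Rpow_mult_distr; field.
    specialize (rk (S k)); simpl in rk |- *; nra.
Qed.

(** * Order of vanishing at the origin and isolation of zeros *)

(* [c] is the leading coefficient; [g] is [f z / z ^ k], filled in by [c] at [0]. *)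
Definition has_order (f : C -> C) (k : nat) (c : C) : Prop :=
  c <> 0 /\
  exists (g : C -> C) (K e : R), (0 <= K)%R /\ (0 < e)%R /\
    forall z, (Cmod z < e)%R ->
      f z = z ^ k * g z /\ (Cmod (g z - c) <= K * Cmod z)%R.

(** The order is the least index of a nonzero Taylor coefficient at 0. If there is none, every
    partial sum is 0 and the germ vanishes. *)
Lemma analytic_order (f : C -> C) :
  analytic_at_origin f -> ~ germ_zero f -> exists k c, has_order f k c.
Proof.
  intros Hf Hn.
  apply locally_singleton in Hf; destruct Hf as [a Ha].
  apply locally_0_Cmod in Ha; destruct Ha as [d [d0 Ha]].
  assert (Hs : forall z, (Cmod z < d)%R ->
    @is_pseries C_AbsRing C_NormedModule a z (f z)).
  { intros z Hz; specialize (Ha z Hz); simpl in Ha.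
    now rewrite Cminus_0_r in Ha. }
  destruct (classic (exists k, a k <> 0)) as [Hex|Hall].
  - destruct (dec_inh_nat_subset_has_unique_least_element (fun k => a k <> 0)
      ltac:(intros; apply classic) Hex) as [k [[Hk Hmin] _]].
    exists k, (a k); split; [easy|].
    destruct (pseries_leading_term a f d k d0 Hs) as [K [e [K0 [e0 HK]]]].
    { intros j Hj; apply NNPP; intros Hj'; specialize (Hmin j Hj'); lia. }
    exists (fun z => if Ceq_dec z 0 then a k else f z / z ^ k), K, e.
    split; [easy|split; [easy|]]; intros z Hz; specialize (HK z Hz).
    destruct (Ceq_dec z 0) as [->|Hz0].
    (* At 0 the remainder bound reads f 0 = a k * 0^k, with 0^0 = 1 when k = 0. *)
    + rewrite Cmod_0 in HK |- *.
      replace (K * 0 ^ S k)%R with 0%R in HK by (simpl; ring).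
      split.
      * assert (E : f 0 - a k * 0 ^ k = 0)
          by (apply Cmod_eq_0, Rle_antisym; [easy|apply Cmod_ge_0]).
        replace (f 0) with (f 0 - a k * 0 ^ k + a k * 0 ^ k) by ring.
        rewrite E; ring.
      * replace (a k - a k) with (RtoC 0) by ring; rewrite Cmod_0; lra.
    + assert (zk : z ^ k <> 0) by now apply Cpow_nz.
      split; [field; easy|].
      apply Rmult_le_reg_l with (Cmod (z ^ k)); [now apply Cmod_gt_0|].
      rewrite <- Cmod_mult.
      replace (z ^ k * (f z / z ^ k - a k)) with (f z - a k * z ^ k)
        by (field; easy).
      rewrite Cmod_pow; simpl in HK; lra.
  - exfalso; apply Hn, locally_0_Cmod; exists d; split; [easy|]; intros z Hz.
    assert (a0 : forall k, a k = 0).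
    { intros k; apply NNPP; intros H; apply Hall; now exists k. }
    apply Cmod_eq_0, Rle_antisym; [|apply Cmod_ge_0].
    replace (f z) with (f z - 0) by ring.
    apply psum_limit_bound with (a := a) (z := z) (N := 0%nat); [now apply Hs|].
    intros m; rewrite psum_first_terms by auto; rewrite a0.
    replace (0 * z ^ (0 + m) - 0) with (RtoC 0) by ring.
    rewrite Cmod_0; lra.
Qed.

(** A zero z <> 0 of f is a zero of g, so |c| <= K |z|, which fails for small z. *)
Lemma order_nonzero (f : C -> C) (k : nat) (c : C) :
  has_order f k c ->
  exists e, (0 < e)%R /\ forall z, (Cmod z < e)%R -> z <> 0 -> f z <> 0.
Proof.
  intros [c0 [g [K [e [K0 [e0 H]]]]]].
  apply Cmod_gt_0 in c0.
  assert (m0 : (0 < Cmod c / (K + 1))%R)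
    by (apply Rdiv_lt_0_compat; lra).
  (* [K + 1] replaces [K] because [K] may be 0. *)
  exists (Rmin e (Cmod c / (K + 1)))%R; split; [now apply Rmin_pos|].
  intros z Hz z0 Hf.
  assert (Hz1 := Rlt_le_trans _ _ _ Hz (Rmin_l _ _)).
  assert (Hz2 := Rlt_le_trans _ _ _ Hz (Rmin_r _ _)).
  destruct (H z Hz1) as [E B].
  rewrite Hf in E; symmetry in E.
  assert (g0 : g z = 0).
  { replace (g z) with (z ^ k * g z / z ^ k) by (field; now apply Cpow_nz).
    rewrite E; field; now apply Cpow_nz. }
  rewrite g0 in B; replace (0 - c) with (- c) in B by ring.
  rewrite Cmod_opp in B.
  apply (Rmult_lt_compat_r (K + 1)) in Hz2; [|lra].
  replace (Cmod c / (K + 1) * (K + 1))%R with (Cmod c) in Hz2 by (field; lra).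
  assert (P := Cmod_ge_0 z); nra.
Qed.

(** * Rigidity of a ratio invariant under multiplication by q *)

Lemma geom_bound_0 (x M r : R) :
  (0 <= r < 1)%R -> (forall n : nat, x <= M * r ^ n)%R -> (x <= 0)%R.
Proof.
  intros Hr H.
  apply Rnot_lt_le; intros x0.
  assert (Mp : (0 < M)%R) by (specialize (H 0%nat); simpl in H; lra).
  destruct (pow_lt_1_zero r ltac:(rewrite Rabs_pos_eq; lra) (x / M)%R
    ltac:(apply Rdiv_lt_0_compat; lra)) as [N HN].
  specialize (HN N (le_n _)); specialize (H N).
  assert (HN' := Rle_lt_trans _ _ _ (Rle_abs _) HN).
  apply (Rmult_lt_compat_l M) in HN'; [|easy].
  replace (M * (x / M))%R with x in HN' by (field; lra); lra.
Qed.

(** Writing the second order as [k + j] lets w^k be cancelled at w = q^n z, leaving f1 z * w^j * g2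
    w = f2 z * g1 w. As n grows, w tends to 0: for j = 0 this becomes c2 f1 = c1 f2, and for j > 0
    it becomes f2 z * c1 = 0, which is impossible for small z <> 0. *)
Lemma q_invariant_ratio (q : C) (f1 f2 : C -> C) (j k : nat) (c1 c2 : C) :
  (0 < Cmod q < 1)%R ->
  has_order f1 k c1 -> has_order f2 (k + j) c2 ->
  germ_zero (fun z => f1 z * f2 (q * z) - f2 z * f1 (q * z)) ->
  j = 0%nat /\ germ_zero (fun z => c2 * f1 z - c1 * f2 z).
Proof.
  intros Hq H1 H2 Hw.
  destruct (order_nonzero _ _ _ H1) as [e1 [e10 nz1]].
  destruct (order_nonzero _ _ _ H2) as [e2 [e20 nz2]].
  destruct H1 as [c10 [g1 [K1 [d1 [K10 [d10 H1]]]]]].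
  destruct H2 as [c20 [g2 [K2 [d2 [K20 [d20 H2]]]]]].
  apply locally_0_Cmod in Hw; destruct Hw as [d3 [d30 Hw]].
  assert (q0 : q <> 0) by (apply Cmod_gt_0; lra).
  set (e := Rmin (Rmin e1 e2) (Rmin (Rmin d1 d2) d3)).
  assert (He : (0 < e /\ e <= e1 /\ e <= e2 /\ e <= d1 /\ e <= d2 /\ e <= d3)%R).
  { unfold e, Rmin; repeat destruct Rle_dec; lra. }
  clearbody e.
  assert (Hqn : forall n z, (Cmod (q ^ n * z) = Cmod z * Cmod q ^ n)%R).
  { intros n z; rewrite Cmod_mult, Cmod_pow; ring. }
  assert (Hsmall : forall n z, (Cmod z < e -> Cmod (q ^ n * z) < e)%R).
  { intros n z Hz; rewrite Hqn.
    assert (Cmod q ^ n <= 1)%R.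
    { replace 1%R with (1 ^ n)%R by apply pow1; apply pow_incr; lra. }
    assert (P := Cmod_ge_0 z); nra. }
  assert (Hnz : forall n (z : C), z <> 0 -> q ^ n * z <> 0).
  { intros n z z0; apply Cmult_neq_0; [now apply Cpow_nz|exact z0]. }
  assert (Hit : forall z, (Cmod z < e)%R -> z <> 0 -> forall n,
    f1 z * f2 (q ^ n * z) = f2 z * f1 (q ^ n * z)).
  { intros z Hz z0; induction n as [|n IH].
    - simpl; replace (1 * z) with z by ring; ring.
    - set (w := q ^ n * z) in *.
      assert (Hw1 : f1 w <> 0).
      { apply nz1; [|now apply Hnz].
        eapply Rlt_le_trans; [now apply Hsmall|lra]. }
      replace (q ^ S n * z) with (q * w) by (unfold w; simpl; ring).
      assert (Hs := Hw w ltac:(eapply Rlt_le_trans; [now apply Hsmall|lra])).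
      simpl in Hs.
      (* Transitivity of equal ratios without division: [f1 w] times the goal combines the
         invariance at [w] with the induction hypothesis, and [f1 w] is nonzero. *)
      assert (Z : f1 w * (f1 z * f2 (q * w) - f2 z * f1 (q * w)) = 0).
      { replace (f1 w * (f1 z * f2 (q * w) - f2 z * f1 (q * w)))
          with (f1 z * (f1 w * f2 (q * w) - f2 w * f1 (q * w))
                + f1 (q * w) * (f1 z * f2 w - f2 z * f1 w)) by ring.
        rewrite Hs, IH; ring. }
      replace (f1 z * f2 (q * w))
        with (f1 w * (f1 z * f2 (q * w) - f2 z * f1 (q * w)) / f1 w
              + f2 z * f1 (q * w)) by (field; easy).
      rewrite Z; field; easy. }
  assert (Hg : forall z, (Cmod z < e)%R -> z <> 0 -> forall n,
    f1 z * ((q ^ n * z) ^ j * g2 (q ^ n * z)) = f2 z * g1 (q ^ n * z)).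
  { intros z Hz z0 n; specialize (Hit z Hz z0 n).
    assert (Hs := Hsmall n z Hz); assert (Hw0 := Hnz n z z0).
    set (w := q ^ n * z) in *.
    destruct (H1 w ltac:(lra)) as [E1 _]; destruct (H2 w ltac:(lra)) as [E2 _].
    rewrite E1, E2, Cpow_add_r in Hit.
    assert (Hk : w ^ k <> 0) by now apply Cpow_nz.
    replace (f1 z * (w ^ j * g2 w)) with (f1 z * (w ^ k * w ^ j * g2 w) / w ^ k)
      by (field; easy).
    rewrite Hit; field; easy. }
  destruct j as [|j].
  - split; [easy|].
    apply locally_0_Cmod; exists e; split; [lra|]; intros z Hz.
    destruct (Ceq_dec z 0) as [->|z0].
    (* At the origin the bounds force g1 0 = c1 and g2 0 = c2, and both functions carry the same
       power of z. *)
    + destruct (H1 0 ltac:(lra)) as [E1 B1]; destruct (H2 0 ltac:(lra)) as [E2 B2].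
      rewrite Cmod_0, Rmult_0_r in B1, B2.
      assert (G1 : g1 0 - c1 = 0)
        by (apply Cmod_eq_0, Rle_antisym; [easy|apply Cmod_ge_0]).
      assert (G2 : g2 0 - c2 = 0)
        by (apply Cmod_eq_0, Rle_antisym; [easy|apply Cmod_ge_0]).
      rewrite E1, E2, Nat.add_0_r.
      replace (g1 0) with (g1 0 - c1 + c1) by ring.
      replace (g2 0) with (g2 0 - c2 + c2) by ring.
      rewrite G1, G2; ring.
    (* The quantity does not depend on n. By [Hg] it equals f2 z (g1 w - c1) - f1 z (g2 w - c2),
       whose modulus is O(|q|^n), so it is 0. *)
    + apply Cmod_eq_0, Rle_antisym; [|apply Cmod_ge_0].
      apply geom_bound_0 with
        (M := ((Cmod (f1 z) * K2 + Cmod (f2 z) * K1) * Cmod z)%R) (r := Cmod q);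
        [lra|]; intros n.
      assert (Hs := Hsmall n z Hz); specialize (Hg z Hz z0 n).
      specialize (Hqn n z); set (w := q ^ n * z) in *.
      destruct (H1 w ltac:(lra)) as [_ B1]; destruct (H2 w ltac:(lra)) as [_ B2].
      rewrite Hqn in B1, B2.
      replace (c2 * f1 z - c1 * f2 z)
        with (f2 z * (g1 w - c1) + - (f1 z * (g2 w - c2))).
      2:{ simpl in Hg.
          replace (f2 z * (g1 w - c1)) with (f2 z * g1 w - f2 z * c1) by ring.
          rewrite <- Hg; ring. }
      eapply Rle_trans; [apply Cmod_triangle|].
      rewrite Cmod_opp, !Cmod_mult.
      assert (P1 := Rmult_le_compat_l _ _ _ (Cmod_ge_0 (f2 z)) B1).
      assert (P2 := Rmult_le_compat_l _ _ _ (Cmod_ge_0 (f1 z)) B2).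
      lra.
  - exfalso.
    (* One nonzero test point suffices. Taking |z| < 1 gives |w| <= 1, hence |w|^(j+1) <= |w|, so
       the left side of [Hg] is O(|q|^n). *)
    set (z := RtoC (Rmin e 1 / 2)).
    assert (Hm : (0 < Rmin e 1)%R) by (apply Rmin_pos; lra).
    assert (Ez : Cmod z = (Rmin e 1 / 2)%R)
      by (unfold z; rewrite Cmod_R; apply Rabs_pos_eq; lra).
    assert (m1 := Rmin_l e 1); assert (m2 := Rmin_r e 1).
    assert (Hz : (Cmod z < e)%R) by lra.
    assert (Hz1 : (Cmod z < 1)%R) by lra.
    assert (z0 : z <> 0) by (apply Cmod_gt_0; lra).
    clearbody z.
    assert (X : Cmod (f2 z * c1) = 0%R).
    { apply Rle_antisym; [|apply Cmod_ge_0].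
      apply geom_bound_0 with
        (M := ((Cmod (f1 z) * (Cmod c2 + K2) + Cmod (f2 z) * K1) * Cmod z)%R)
        (r := Cmod q); [lra|]; intros n.
      assert (Hs := Hsmall n z Hz); specialize (Hg z Hz z0 n).
      specialize (Hqn n z).
      assert (W1 : (Cmod (q ^ n * z) <= 1)%R).
      { rewrite Hqn.
        assert (Cmod q ^ n <= 1)%R.
        { replace 1%R with (1 ^ n)%R by apply pow1; apply pow_incr; lra. }
        assert (P := Cmod_ge_0 z); nra. }
      set (w := q ^ n * z) in *.
      destruct (H1 w ltac:(lra)) as [_ B1]; destruct (H2 w ltac:(lra)) as [_ B2].
      assert (W0 := Cmod_ge_0 w).
      assert (G2 : (Cmod (g2 w) <= Cmod c2 + K2)%R).
      { replace (g2 w) with (c2 + (g2 w - c2)) by ring.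
        eapply Rle_trans; [apply Cmod_triangle|]; nra. }
      assert (Wj : (Cmod (w ^ S j * g2 w) <= Cmod w * (Cmod c2 + K2))%R).
      { rewrite Cmod_mult; apply Rmult_le_compat; try apply Cmod_ge_0; [|easy].
        rewrite Cmod_pow; simpl.
        assert (Cmod w ^ j <= 1)%R.
        { replace 1%R with (1 ^ j)%R by apply pow1; apply pow_incr; lra. }
        nra. }
      replace (f2 z * c1)
        with (f1 z * (w ^ S j * g2 w) + - (f2 z * (g1 w - c1)))
        by (rewrite Hg; ring).
      eapply Rle_trans; [apply Cmod_triangle|].
      rewrite Cmod_opp, (Cmod_mult (f1 z)), (Cmod_mult (f2 z)).
      assert (P1 := Rmult_le_compat_l _ _ _ (Cmod_ge_0 (f2 z)) B1).
      assert (P2 := Rmult_le_compat_l _ _ _ (Cmod_ge_0 (f1 z)) Wj).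
      rewrite Hqn in P1, P2; lra. }
    apply Cmod_eq_0 in X.
    apply (Cmult_neq_0 (f2 z) c1); try easy.
    apply nz2; [lra|easy].
Qed.

(** * The Jackson difference of the Casorati determinant *)

Lemma qz_minus_z_neq_0 (q z : C) : (Cmod q < 1)%R -> z <> 0 -> q * z - z <> 0.
Proof.
  intros Hq z0 E.
  assert (q1 : q - 1 <> 0).
  { intros E1; assert (q = 1) by (replace q with (q - 1 + 1) by ring; rewrite E1; ring).
    subst q; rewrite Cmod_1 in Hq; lra. }
  apply (Cmult_neq_0 (q - 1) z q1 z0); rewrite <- E; ring.
Qed.

Lemma Dq_neq_0 (q : C) (f : C -> C) (z : C) :
  z <> 0 -> Dq q f z = (f (q * z) - f z) / (q * z - z).
Proof. intros z0; unfold Dq; now destruct (Ceq_dec z 0). Qed.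

Lemma casorati_q_minor (q : C) (f1 f2 : C -> C) (z : C) :
  (Cmod q < 1)%R -> z <> 0 ->
  (q * z - z) * casorati q f1 f2 z = f1 z * f2 (q * z) - f2 z * f1 (q * z).
Proof.
  intros Hq z0; assert (D := qz_minus_z_neq_0 q z Hq z0).
  unfold casorati; rewrite !Dq_neq_0 by easy; field; easy.
Qed.

(** A q-analogue of differentiating a Wronskian. The equation expresses D_q f(qz) through D_q f(z)
    and A(z) f(z); after substitution the two products D_q f1 * D_q f2 cancel and only the terms
    with A remain. *)
Lemma Dq_casorati (q : C) (A f1 f2 : C -> C) (z : C) :
  (Cmod q < 1)%R -> z <> 0 ->
  Dq q (Dq q f1) z + A z * f1 z = 0 ->
  Dq q (Dq q f2) z + A z * f2 z = 0 ->
  Dq q (casorati q f1 f2) z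
    = A z * (f1 z * f2 (q * z) - f2 z * f1 (q * z)).
Proof.
  intros Hq z0 E1 E2; assert (D := qz_minus_z_neq_0 q z Hq z0).
  assert (S : forall f, Dq q (Dq q f) z + A z * f z = 0 ->
    Dq q f (q * z) = Dq q f z - (q * z - z) * (A z * f z)).
  { intros f E; rewrite (Dq_neq_0 q (Dq q f)) in E by easy.
    replace (Dq q f (q * z)) with
      ((q * z - z) * ((Dq q f (q * z) - Dq q f z) / (q * z - z) + A z * f z)
       + Dq q f z - (q * z - z) * (A z * f z)) by (field; easy).
    rewrite E; ring. }
  rewrite Dq_neq_0 by easy; unfold casorati.
  rewrite (S f1 E1), (S f2 E2), !(Dq_neq_0 q _ z) by easy.
  field; easy.
Qed.

Theorem theorem3p1 (q : C) (A f1 f2 : C -> C)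
  (hq : (0 < Cmod q < 1)%R)
  (hA : analytic_at_origin A) (hA0 : ~ germ_zero A)
  (hf1 : analytic_at_origin f1) (hf2 : analytic_at_origin f2)
  (hs1 : jackson_solution q A f1) (hs2 : jackson_solution q A f2)
  (hind : lin_indep f1 f2) :
  ~ in_ker_Dq q (casorati q f1 f2).
Proof.
  intros hker.
  assert (C1 : RtoC 1 <> 0) by (intros E; apply (f_equal fst) in E; simpl in E; lra).
  assert (n1 : ~ germ_zero f1).
  { intros H; apply C1, (hind 1 0); revert H; apply germ_zero_imp; intros z E.
    rewrite E; ring. }
  assert (n2 : ~ germ_zero f2).
  { intros H; apply C1, (hind 0 1); revert H; apply germ_zero_imp; intros z E.
    rewrite E; ring. }
  destruct (analytic_order A hA hA0) as [kA [cA oA]].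
  destruct (analytic_order f1 hf1 n1) as [k1 [c1 o1]].
  destruct (analytic_order f2 hf2 n2) as [k2 [c2 o2]].
  destruct (order_nonzero _ _ _ oA) as [eA [eA0 nzA]].
  assert (W : germ_zero (fun z => f1 z * f2 (q * z) - f2 z * f1 (q * z))).
  { assert (LA : locally (RtoC 0) (fun z : C => z <> 0 -> A z <> 0)).
    { apply locally_0_Cmod; exists eA; split; [easy|]; exact nzA. }
    unfold in_ker_Dq, jackson_solution, germ_zero in *.
    generalize (filter_and _ _ LA (filter_and _ _ hker (filter_and _ _ hs1 hs2))).
    apply filter_imp; intros z [a0 [Hk [E1 E2]]].
    (* At z = 0 the minor cancels identically because q * 0 = 0; elsewhere the nonzero factor A z is
       cancelled. *)
    destruct (Ceq_dec z 0) as [->|z0].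
    - replace (q * 0) with (RtoC 0) by ring; ring.
    - rewrite (Dq_casorati q A f1 f2 z) in Hk by easy.
      apply NNPP; intros Hn; now apply (Cmult_neq_0 _ _ (a0 z0) Hn). }
  (* [q_invariant_ratio] expects the function of smaller order first. Exchanging f1 and f2 only
     changes the sign of the minor. Either way the relation c2 f1 = c1 f2 with nonzero leading
     coefficients contradicts independence. *)
  destruct (Nat.le_ge_cases k1 k2) as [Hle|Hle].
  - replace k2 with (k1 + (k2 - k1))%nat in o2 by lia.
    destruct (q_invariant_ratio q f1 f2 _ k1 c1 c2 hq o1 o2 W) as [_ L].
    apply (proj1 o2), (hind c2 (- c1)); revert L; apply germ_zero_imp; intros z E.
    rewrite <- E; ring.
  - replace k1 with (k2 + (k1 - k2))%nat in o1 by lia.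
    destruct (q_invariant_ratio q f2 f1 _ k2 c2 c1 hq o2 o1) as [_ L].
    { revert W; apply germ_zero_imp; intros z E.
      replace (f2 z * f1 (q * z) - f1 z * f2 (q * z))
        with (- (f1 z * f2 (q * z) - f2 z * f1 (q * z))) by ring.
      rewrite E; ring. }
    apply (proj1 o1), (hind (- c2) c1); revert L; apply germ_zero_imp; intros z E.
    rewrite <- E; ring.
Qed.
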